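(* For every integer $n \geq 3$, the number $c_4(n)$ of cyclic permutations of length $n$ in the $\sigma$-class with signature $\sigma_4 = -+-$ satisfies \[ c_4(n) = \frac{L_3^*(n;\sigma_4)}{4}. \]
   Context: $\mathcal S_n$ is the set of permutations of $[n]=\{1,\dots,n\}$, written in one-line notation $\pi=\pi_1\cdots\pi_n$. A permutation is cyclic if its cycle decomposition consists of a single $n$-cycle; $\mathcal C_n$ is the set of cyclic permutations in $\mathcal S_n$. For a signature $\sigma=\sigma^0\sigma^1\cdots\sigma^{k-1}\in\{+,-\}^k$, the $\sigma$-class $\mathcal S^\sigma_n$ is the set of $\pi\in\mathcal S_n$ for which there exist integers $0=e_0\le e_1\le\cdots\le e_k=n$ such that for each $i\in\{0,\dots,k-1\}$ the segment $\pi_{e_i+1}\cdots\pi_{e_{i+1}}$ is increasing if $\sigma^i=+$ and decreasing if $\sigma^i=-$. Set $\mathcal C_n^\sigma=\mathcal C_n\cap\mathcal S_n^\sigma$ and $c_4(n)=|\mathcal C_n^{-+-}|$. A word of length $m$ on $k$ letters is a sequence $s=s_1\cdots s_m$ with $s_j\in\{0,1,\dots,k-1\}$; it is primitive if it is not of the form $q^r$ for any $r>1$. A necklace is an equivalence class of words under cyclic rotation; it is primitive if its representatives are primitive. $L_k(m)$ denotes the number of primitive necklaces of length $m$ on $k$ letters. For $\sigma\in\{+,-\}^k$ let $T_\sigma^-=\{i:\sigma^i=-\}$ and $o_\sigma(s)=|\{j: s_j\in T_\sigma^-\}|$. $L_k(m;\sigma)$ denotes the number of primitive necklaces of length $m$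 on $k$ letters whose representatives $s$ have $o_\sigma(s)$ odd, with $L_k(m;\sigma)=0$ if $m$ is not an integer. $L_k^*(n;\sigma)=L_k(n)+L_k(\tfrac n2;\sigma)$. *)

(* Defs.v *)
From mathcomp Require Import all_boot all_fingroup all_algebra.
Set Implicit Arguments. Unset Strict Implicit. Unset Printing Implicit Defensive.

(* Signatures: seq bool, true = '+', false = '-'. *)
Definition sigma4 : seq bool := [:: false; true; false].

(* A permutation s : {perm 'I_n} is read in one-line notation pi_(a+1) = s a + 1
   (0-indexed positions/values; order comparisons are unaffected). *)

Definition cyclic_perm n (s : {perm 'I_n}) : bool := #|porbits s| == 1.

Definition in_sigma_class (sg : seq bool) n (s : {perm 'I_n}) : bool :=
  [exists e : {ffun 'I_(size sg).+1 -> 'I_n.+1},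
    [&& val (e ord0) == 0,
        val (e ord_max) == n,
        [forall i : 'I_(size sg), e (inord i) <= e (inord i.+1)] &
        [forall i : 'I_(size sg), forall a : 'I_n, forall b : 'I_n,
           [&& e (inord i) <= a, a < b & b < e (inord i.+1)] ==>
           (if nth true sg i then s a < s b else s b < s a)]]].

Definition cyc_class_count (sg : seq bool) n : nat :=
  #|[set s : {perm 'I_n} | cyclic_perm s && in_sigma_class sg s]|.

Definition c4 n : nat := cyc_class_count sigma4 n.

(* w is NOT primitive iff w = q^r for some word q and some r > 1
   (the bounds on |q| and r are harmless since |q| * r = m, with r < m.+2). *)
Definition primitive_word k m (w : m.-tuple 'I_k) : bool :=
  ~~ [exists j : 'I_m.+1, exists q : j.-tuple 'I_k, exists r : 'I_m.+2,
        (1 < r) && (val w == flatten (nseq r (val q)))].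

Definition necklace k m (w : m.-tuple 'I_k) : {set m.-tuple 'I_k} :=
  [set w' : m.-tuple 'I_k | [exists i : 'I_m.+1, val w' == rot i (val w)]].

Definition Lneck k m : nat :=
  #|[set necklace w | w in [set w : m.-tuple 'I_k | primitive_word w]]|.

Definition o_sig (sg : seq bool) k m (w : m.-tuple 'I_k) : nat :=
  count (fun x : 'I_k => ~~ nth true sg x) (val w).

(* L_k(m; sigma): number of primitive necklaces whose representatives have
   o_sigma odd (o_sigma is rotation invariant) *)
Definition Lneck_sig k (sg : seq bool) m : nat :=
  #|[set necklace w | w in
       [set w : m.-tuple 'I_k | primitive_word w && odd (o_sig sg w)]]|.

Definition Lstar k (sg : seq bool) n : nat :=
  Lneck k n + (if odd n then 0 else Lneck_sig k sg n./2).

(* Main.v *)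
Require Import Defs.
From mathcomp Require Import all_boot all_fingroup all_algebra.
From mathcomp Require Import zify.
Set Implicit Arguments. Unset Strict Implicit. Unset Printing Implicit Defensive.

(* Color the positions of a permutation by the segment of the signature containing
   them; the colors met along the orbit of a point form a word.  The relative order
   of two points of the orbit is read off the first letter where their itineraries
   differ, and is reversed at each negative letter passed before.  Hence a cyclic
   permutation together with its coloring is determined by a necklace.  Two points
   with the same itinerary must be exchanged by an odd number of reversals, so the
   necklaces that occur are the primitive ones and the squares of primitive ones of
   odd parity, whose number is L*.  For the signature -+- and n >= 3 a cyclic
   permutation has an ascent, and each of the two cuts can be put on either side of
   the valley, respectively of the peak, which gives 4 colorings. *)

(** * Periods of infinite sequences *)

Section Period.

Variables (T : Type) (s : nat -> T).

Definition period d := forall i, s (i + d) = s i.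

Lemma period_mul d c : period d -> period (c * d).
Proof. by move=> sd; elim: c => [|c IHc] i; rewrite ?addn0 // mulSnr addnA sd. Qed.

Lemma period_eqmod d i j : period d -> i = j %[mod d] -> s i = s j.
Proof.
move=> sd eq_ij; rewrite (divn_eq i d) (divn_eq j d) eq_ij.
rewrite (addnC (_ %/ d * d)) (addnC (j %/ d * d)).
by rewrite (period_mul (i %/ d) sd) (period_mul (j %/ d) sd).
Qed.

Lemma period_cancel a b : period b -> period (a + b) -> period a.
Proof. by move=> sb sab i; rewrite -sb -addnA sab. Qed.

(** By Bézout, the gcd plus some multiple of [b] is a multiple of [a]; the multiple of [b]
    cancels. *)
Lemma period_gcd a b : 0 < a -> period a -> period b -> period (gcdn a b).
Proof.
move=> a_gt0 sa sb; have [c _ /dvdnP[e def_e]] := Bezoutl b a_gt0.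
apply: (@period_cancel _ (c * b)); first exact: period_mul.
by rewrite def_e; apply: period_mul.
Qed.

(** Every position is congruent modulo [n] to one at or beyond [a], so a relation valid from [a] on
    is valid everywhere. *)
Lemma period_shift n a d : period n -> 0 < n ->
  (forall t, s (a + t + d) = s (a + t)) -> period d.
Proof.
move=> sn n_gt0 sd i; have := sd (i + a * n - a).
rewrite subnKC; last by rewrite (leq_trans (leq_pmulr a n_gt0)) ?leq_addl.
by rewrite (period_mul a sn) addnAC (period_mul a sn).
Qed.

End Period.

(** * Itineraries of a cyclic orbit: the possible words and the uniqueness of the order *)

Section Parity.

Variables (k : nat) (neg : pred 'I_k).

Definition parity (s : nat -> 'I_k) i := odd (\sum_(t < i) neg (s t)).

Lemma parityS s i : parity s i.+1 = parity s i (+) neg (s i).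
Proof. by rewrite /parity big_ord_recr oddD; case: neg. Qed.

Lemma parityD s d i : period s d -> parity s (i + d) = parity s i (+) parity s d.
Proof.
move=> sd; elim: i => [|i IHi]; first by rewrite /parity big_ord0.
by rewrite addSn !parityS IHi sd addbAC.
Qed.

(* [x] lists the points of an orbit of length [n] whose itinerary is [s]:
   the map is monotone with respect to letters, increasing on positive letters
   and decreasing on negative ones. *)
Record itinerary n (s : nat -> 'I_k) (x : nat -> nat) : Prop := Itinerary {
  itin_period : period s n;
  itin_eq : forall i j, (x i == x j) = (i == j %[mod n]);
  itin_lt : forall i j, s i < s j -> x i < x j;
  itin_step : forall i j, s i = s j -> x i != x j ->
    (x i < x j) = (x i.+1 < x j.+1) (+) neg (s i) }.

(** For an [n]-periodic [s], the repeated word of length [n] is either primitive or the square of a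
    primitive word of length [h] with an odd number of negative letters. *)
Definition good_word n (s : nat -> 'I_k) :=
  (forall d, period s d -> n %| d) \/
  (exists h, [/\ n = h + h, period s h, forall d, period s d -> h %| d
               & parity s h]).

Section Orbit.

Variables (n : nat) (s : nat -> 'I_k) (x : nat -> nat).
Hypotheses (n_gt0 : 0 < n) (itx : itinerary n s x).

Let x_neq i d : ~~ (n %| d) -> x i != x (i + d).
Proof. by rewrite (itin_eq itx) eq_sym eqn_mod_dvd ?leq_addr // addKn. Qed.

(** The two points carry the same letters, and each step reverses their order exactly at a negative
    letter. *)
Lemma itin_parity i d : period s d -> ~~ (n %| d) ->
  (x i < x (i + d)) = (x 0 < x d) (+) parity s i.
Proof.
move=> sd nd; elim: i => [|i IHi]; first by rewrite /parity big_ord0 addbF.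
have:= @itin_step _ _ _ itx i (i + d) (esym (sd i)) (x_neq i nd).
by rewrite IHi parityS addbA => ->; rewrite -addbA addbb addbF.
Qed.

(** Otherwise the points [x 0], [x d], [x (2 * d)], ... form a strictly monotone sequence, since
    jumps by [d] preserve the order; but the sequence returns to [x 0] after [n] jumps. *)
Lemma even_period d : period s d -> ~~ parity s d -> n %| d.
Proof.
move=> sd evd; apply: contraT => nd.
have Pm c : parity s (c * d) = false.
  elim: c => [|c IHc]; first by rewrite /parity big_ord0.
  by rewrite mulSn addnC parityD // IHc; apply: negbTE.
have lt c : (x (c * d) < x (c.+1 * d)) = (x 0 < x d).
  by rewrite mulSn addnC itin_parity // Pm addbF.
have xn0 : x (n * d) = x 0.
  by apply/eqP; rewrite (itin_eq itx) modnMr mod0n.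
have neq c : x (c * d) != x (c.+1 * d) by rewrite mulSn addnC x_neq.
have [lt0|ge0] := boolP (x 0 < x d).
  have inc c : x 0 + c <= x (c * d).
    elim: c => [|c IHc]; first by rewrite addn0.
    by have := lt c; rewrite lt0; lia.
  by have := inc n; lia.
have dec c : x (c * d) + c <= x 0.
  elim: c => [|c IHc]; first by rewrite addn0.
  by have := lt c; rewrite (negbTE ge0); have := neq c; lia.
by have := dec n; lia.
Qed.

Lemma double_period d : period s d -> n %| d + d.
Proof.
move=> sd; apply: even_period; last by rewrite parityD // addbb.
by move=> i; rewrite addnA !sd.
Qed.

Lemma half_dvd h d : n = h + h -> period s d -> h %| d.
Proof. by move=> def_n /double_period; rewrite def_n !addnn -!muln2 dvdn_pmul2r. Qed.

Lemma odd_double_dvd d : n %| d + d -> ~~ (n %| d) -> ~~ odd n.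
Proof.
move=> n2d; apply: contra => n_odd; rewrite -(@Gauss_dvdr n 2) ?coprimen2 //.
by rewrite mul2n -addnn.
Qed.

Lemma nondvd_half h d : n = h + h -> period s d -> ~~ (n %| d) ->
  d = h %[mod n].
Proof.
move=> def_n sd; have /dvdnP[c ->] := half_dvd def_n sd.
rewrite def_n addnn -mul2n => c_odd.
have h_gt0 : 0 < h by lia.
rewrite [RHS]modn_small; last by lia.
by move: c_odd; rewrite -muln_modl dvdn_pmul2r // dvdn2 negbK modn2 => ->; rewrite mul1n.
Qed.

Lemma itinerary_good : good_word n s.
Proof.
(* Testing [0 < d < n] suffices, since a period can be replaced by its gcd with [n]. *)
have [/forallP all_dvd|] :=
  boolP [forall d : 'I_n, (0 < d) ==> ~~ [forall i : 'I_n, s (i + d) == s i]].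
  left=> d sd; have sg := period_gcd n_gt0 (itin_period itx) sd.
  have [lt_gn|] := ltnP (gcdn n d) n; last first.
    move=> ge_gn; suff <- : gcdn n d = n by apply: dvdn_gcdr.
    by apply/eqP; rewrite eqn_leq ge_gn dvdn_leq ?dvdn_gcdl.
  have := all_dvd (Ordinal lt_gn); rewrite /= gcdn_gt0 n_gt0 /=.
  by case/forallP=> i; rewrite sg.
case/forallPn=> d; rewrite negb_imply negbK => /andP[d_gt0 /forallP sd].
right; have {}sd : period s d.
  move=> i; have := sd (Ordinal (ltn_pmod i n_gt0)) => /= /eqP eq_d.
  rewrite -(period_eqmod (itin_period itx) (modn_mod i n)) -eq_d.
  by apply: (period_eqmod (itin_period itx)); rewrite modnDml.
have nd : ~~ (n %| d) by rewrite gtnNdvd.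
have def_n : n = n./2 + n./2.
  by have := odd_double_dvd (double_period sd) nd; lia.
have sh : period s n./2.
  move=> i; rewrite -[RHS]sd; apply: (period_eqmod (itin_period itx)).
  by rewrite -modnDmr -(nondvd_half def_n sd nd) modnDmr.
exists n./2; split=> // [e|]; first exact: half_dvd.
by apply: contraT => /(even_period sh) /dvdn_leq; lia.
Qed.

End Orbit.

(** Two points ordered differently must have equal letters, and the step rule passes the
    disagreement on to their successors. Their itineraries then agree forever, so [j - i] is a
    period, congruent to [n./2], and [itin_parity] reduces both orders to the pair [0], [n./2] of
    the hypothesis. *)
Lemma itinerary_uniq n s x y : 0 < n -> itinerary n s x -> itinerary n s y ->
  (forall h, n = h + h -> period s h -> (x 0 < x h) = (y 0 < y h)) ->
  forall i j, (x i < x j) = (y i < y j).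
Proof.
move=> n_gt0 itx ity eq0h i j.
have [/eqP //|neq_ij] := boolP ((x i < x j) == (y i < y j)); exfalso.
have {neq_ij} D t : s (i + t) = s (j + t) /\
    (x (i + t) < x (j + t)) != (y (i + t) < y (j + t)).
  have sep a b : (x a < x b) != (y a < y b) -> s a = s b.
    move=> Dab; apply/val_inj/eqP; apply: contraT => /=; case: ltngtP => // lt_ab _.
      by rewrite (itin_lt itx lt_ab) (itin_lt ity lt_ab) in Dab.
    by rewrite !ltnNge (ltnW (itin_lt itx lt_ab)) (ltnW (itin_lt ity lt_ab)) in Dab.
  elim: t => [|t [eq_s Dt]]; first by rewrite !addn0; split; first exact: sep.
  suff Dt1: (x (i + t.+1) < x (j + t.+1)) != (y (i + t.+1) < y (j + t.+1)).
    by split; first exact: sep.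
  have eqxy : (x (i + t) == x (j + t)) = (y (i + t) == y (j + t)).
    by rewrite (itin_eq itx) (itin_eq ity).
  have neqx : x (i + t) != x (j + t).
    apply: contra Dt => eqx; move: (eqx); rewrite eqxy => /eqP ->.
    by rewrite (eqP eqx) !ltnn.
  have neqy : y (i + t) != y (j + t) by rewrite -eqxy.
  move: Dt; rewrite (itin_step itx eq_s neqx) (itin_step ity eq_s neqy) !addnS.
  by do 2!case: (_ < _); case: neg.
(* [d] represents [j - i] modulo [n]; the term [i * n] keeps the subtraction from truncating. *)
pose d := j + i * n - i.
have le_i : i <= j + i * n by rewrite (leq_trans (leq_pmulr i n_gt0)) ?leq_addl.
have jd t : j + t = i + t + d %[mod n].
  have -> : i + t + d = j + t + i * n by rewrite /d; lia.
  by rewrite -[RHS]modnDmr modnMl addn0.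
have sd : period s d.
  apply: (@period_shift _ _ n i) => //; first exact: itin_period itx.
  by move=> t; rewrite (D t).1; apply/esym/(period_eqmod (itin_period itx))/jd.
have xj t : x (j + t) = x (i + t + d) by apply/eqP; rewrite (itin_eq itx) jd.
have yj t : y (j + t) = y (i + t + d) by apply/eqP; rewrite (itin_eq ity) jd.
have nd : ~~ (n %| d).
  have := (D 0).2; rewrite xj yj; apply: contra => n_d.
  have xx : x (i + 0 + d) == x (i + 0).
    by rewrite (itin_eq itx) -modnDmr (eqP n_d) addn0.
  have yy : y (i + 0 + d) == y (i + 0) by rewrite (itin_eq ity) -(itin_eq itx).
  by rewrite (eqP xx) (eqP yy) !ltnn.
have def_n : n = n./2 + n./2.
  by have := odd_double_dvd (double_period n_gt0 itx sd) nd; lia.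
have dh := nondvd_half n_gt0 itx def_n sd nd.
have sh : period s n./2.
  move=> a; rewrite -[RHS]sd; apply: (period_eqmod (itin_period itx)).
  by rewrite -modnDmr -dh modnDmr.
have := (D 0).2; rewrite xj yj (itin_parity itx) // (itin_parity ity) //.
have /eqP -> : x d == x n./2 by rewrite (itin_eq itx) dh.
have /eqP -> : y d == y n./2 by rewrite (itin_eq ity) dh.
by rewrite eq0h // eqxx.
Qed.
End Parity.

(** * Construction of an orbit order from a good word *)

Section Key.

Variables (k : nat) (neg : pred 'I_k) (s : nat -> 'I_k).

(* The first [N] letters of the shifted word [s_i s_(i+1) ...] read as a base [k]
   expansion, complementing the tail after each negative letter. *)
Fixpoint code N i :=
  if N is N'.+1 then
    s i * k ^ N' + (if neg (s i) then (k ^ N').-1 - code N' i.+1 else code N' i.+1)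
  else 0.

Lemma code_lt N i : code N i < k ^ N.
Proof.
elim: N i => [|N IHN] i; first by rewrite expn0.
have lt_c := IHN i.+1.
have : (s i).+1 * k ^ N <= k * k ^ N by rewrite leq_mul2r ltn_ord orbT.
rewrite mulSn /= expnS; move: lt_c.
by move: (k ^ N) (code N i.+1) (k * _) (s i * _) => q c a b; case: neg; lia.
Qed.

Lemma code_letter_lt N i j : s i < s j -> code N.+1 i < code N.+1 j.
Proof.
move=> lt_s; have := code_lt N i.+1; have := code_lt N j.+1.
have : (s i).+1 * k ^ N <= s j * k ^ N by rewrite leq_mul2r lt_s orbT.
rewrite mulSn /=.
move: (k ^ N) (code N i.+1) (code N j.+1) (s i * _) (s j * _) => q ci cj a b.
by do 2!case: neg; lia.
Qed.

Lemma code_step N i j : s i = s j ->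
  (code N.+1 i < code N.+1 j) =
  if neg (s i) then code N j.+1 < code N i.+1 else code N i.+1 < code N j.+1.
Proof.
move=> eq_s; have := code_lt N i.+1; have := code_lt N j.+1.
rewrite /= eq_s.
move: (k ^ N) (code N i.+1) (code N j.+1) (s j * _) => q ci cj a.
by case: neg; lia.
Qed.

(** The order is settled at the first letter where the expansions differ; further letters only break
    ties. *)
Lemma code_mono N i j : code N i < code N j -> code N.+1 i < code N.+1 j.
Proof.
elim: N i j => [|N IHN] i j; first by rewrite ltnn.
case: (ltngtP (s i) (s j)) => [lt_s|lt_s|/val_inj eq_s]; first by move=> _; apply: code_letter_lt.
  by move=> lt_c; have := code_letter_lt N lt_s; lia.
by rewrite !(code_step _ eq_s); case: neg; apply: IHN.
Qed.

Lemma eq_code N i j : code N i = code N j -> forall t, t < N -> s (i + t) = s (j + t).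
Proof.
elim: N i j => [|N IHN] i j // eq_c.
have eq_s : s i = s j.
  apply/val_inj/eqP; case: ltngtP => // lt_s; have := code_letter_lt N lt_s.
    by rewrite eq_c ltnn.
  by rewrite eq_c ltnn.
have {}eq_c : code N i.+1 = code N j.+1.
  have := code_lt N i.+1; have := code_lt N j.+1.
  move: eq_c; rewrite /= eq_s.
  move: (k ^ N) (code N i.+1) (code N j.+1) (s j * _) => q ci cj a.
  by case: neg; lia.
by case=> [|t] lt_t; rewrite ?addn0 // !addnS -!addSn; apply: IHN.
Qed.

Lemma code_eqmod n N i j : period s n -> i = j %[mod n] -> code N i = code N j.
Proof.
move=> sn; elim: N i j => //= N IHN i j eq_ij.
rewrite (period_eqmod sn eq_ij) (IHN i.+1 j.+1) //.
by rewrite -[i.+1]addn1 -[j.+1]addn1 -modnDml eq_ij modnDml.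
Qed.

Variable n : nat.
Hypotheses (n_gt0 : 0 < n) (sn : period s n) (good : good_word neg n s).

(** Doubling the code frees a low bit that separates positions sharing a code; the index is reduced
    so that the key is [n]-periodic. *)
Definition orbit_key i := (code n i).*2 + parity neg s (i %% n).

Let code_period i j : code n i = code n j -> exists2 d, period s d & j = i + d %[mod n].
Proof.
move=> eq_c; pose d := j + i * n - i.
have le_i : i <= j + i * n by rewrite (leq_trans (leq_pmulr i n_gt0)) ?leq_addl.
have jd t : j + t = i + t + d %[mod n].
  have -> : i + t + d = j + t + i * n by rewrite /d; lia.
  by rewrite -[RHS]modnDmr modnMl addn0.
exists d; last by have := jd 0; rewrite !addn0.
apply: (@period_shift _ _ n i) => // t.
rewrite -(period_eqmod sn (jd t)).
have modt a : a + t = a + t %% n %[mod n] by rewrite modnDmr.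
rewrite (period_eqmod sn (modt i)) (period_eqmod sn (modt j)).
exact: esym (eq_code eq_c (ltn_pmod t n_gt0)).
Qed.

(* Two shifts of a good word can only agree if the word is a square of odd parity,
   in which case the parities of the two prefixes differ. *)
Let code_parity i j : code n i = code n j -> i <> j %[mod n] ->
  [/\ parity neg s (i %% n) = ~~ parity neg s (j %% n)
    & forall a, parity neg s (a %% n) = parity neg s a].
Proof.
move=> eq_c neq_ij; have [d sd jd] := code_period eq_c.
have nd : ~~ (n %| d).
  by apply/negP => /eqP d0; apply: neq_ij; rewrite jd -modnDmr d0 addn0.
case: good => [/(_ d sd)|[h [def_n sh minh Ph]]]; first by rewrite (negbTE nd).
have Pn c : parity neg s (c * n) = false.
  elim: c => [|c IHc]; first by rewrite /parity big_ord0.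
  by rewrite mulSnr parityD // IHc def_n parityD // Ph.
have Pmod a : parity neg s (a %% n) = parity neg s a.
  rewrite [in RHS](divn_eq a n) addnC parityD; last exact: period_mul.
  by rewrite Pn addbF.
split=> //; rewrite jd !Pmod parityD //.
have /dvdnP[c def_d] := minh d sd.
suff -> : parity neg s d by rewrite addbT negbK.
have Pc b : parity neg s (b * h) = odd b.
  elim: b => [|b IHb]; first by rewrite /parity big_ord0.
  by rewrite mulSnr parityD // IHb Ph addbT.
rewrite def_d Pc; apply: contraR nd => /negPf c_even.
by rewrite def_d def_n; apply/dvdnP; exists c./2; have := odd_double_half c; rewrite c_even; nia.
Qed.

Let key_lt i j : (orbit_key i < orbit_key j) =
  (code n i < code n j) ||
  (code n i == code n j) && (parity neg s (i %% n) < parity neg s (j %% n)).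
Proof. by rewrite /orbit_key; do 2!case: parity; case: ltngtP => /=; lia. Qed.

Lemma orbit_key_itinerary : itinerary neg n s orbit_key.
Proof.
have key_eq i j : (orbit_key i == orbit_key j) = (i == j %[mod n]).
  apply/eqP/eqP=> [eq_key|eq_ij]; last by rewrite /orbit_key (code_eqmod _ sn eq_ij) eq_ij.
  have eq_c : code n i = code n j.
    by move: eq_key; rewrite /orbit_key; do 2!case: parity; lia.
  apply/eqP; apply: contraT => /eqP /(code_parity eq_c) [neqP _].
  by move: eq_key; rewrite /orbit_key eq_c neqP; case: parity; lia.
split=> // [i j lt_s|i j eq_s].
  by rewrite key_lt; move: n_gt0; case: (n) => // m _; rewrite code_letter_lt.
rewrite key_eq => /eqP neq_ij.
(* [code_mono] adds a letter and [code_step] removes one, so codes of length [n] are compared both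
   before and after the step. *)
have sub a b : s a = s b -> code n a < code n b ->
    if neg (s a) then orbit_key b.+1 < orbit_key a.+1 else orbit_key a.+1 < orbit_key b.+1.
  move=> eq_ab /code_mono; rewrite (code_step _ eq_ab) !key_lt.
  by case: neg => ->.
case: (ltngtP (code n i) (code n j)) => [lt_c|lt_c|eq_c].
- rewrite key_lt lt_c /=; have := sub _ _ eq_s lt_c.
  by case: neg => [|->] //; case: ltngtP.
- rewrite key_lt ltnNge (ltnW lt_c) /= (gtn_eqF lt_c) /=.
  have := sub _ _ (esym eq_s) lt_c; rewrite eq_s.
  by case: neg => [->|] //; case: ltngtP.
(* On a tie the low bits decide: they are opposite, and a negative letter flips both, which reverses
   the order. *)
have [neqP Pmod] := code_parity eq_c neq_ij.
have eq_c1 : code n i.+1 = code n j.+1.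
  have [d sd jd] := code_period eq_c.
  rewrite (code_eqmod _ sn (_ : j.+1 = i.+1 + d %[mod n])); last first.
    by rewrite -[i.+1]addn1 -[j.+1]addn1 addnAC -modnDml jd modnDml.
  by elim: (n) (i.+1) => //= m IHm a; rewrite sd -addSn IHm.
rewrite !key_lt eq_c eq_c1 !ltnn !eqxx /= !Pmod !parityS -eq_s.
by move: neqP; rewrite !Pmod => ->; case: parity; case: neg.
Qed.

End Key.

(** * Powers of words, rotations and primitivity *)

Lemma nth_flatten_nseq (T : Type) (x0 : T) r (q : seq T) i :
  i < r * size q -> nth x0 (flatten (nseq r q)) i = nth x0 q (i %% size q).
Proof.
elim: r i => [|r IHr] i //=; rewrite nth_cat mulSn => lt_i.
have [lt_iq|le_qi] := ltnP i (size q); first by rewrite modn_small.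
by rewrite IHr ?ltn_subLR // -[in RHS](subnK le_qi) modnDr.
Qed.

Lemma size_flatten_nseq (T : Type) r (q : seq T) :
  size (flatten (nseq r q)) = r * size q.
Proof. by elim: r => //= r IHr; rewrite size_cat IHr mulSn. Qed.

Section Necklace.

Variables (k n : nat).
Hypothesis n_gt0 : 0 < n.
Implicit Types w : n.-tuple 'I_k.

Definition unroll w i := tnth w (Ordinal (ltn_pmod i n_gt0)).

Lemma unroll_nth x0 w i : unroll w i = nth x0 w (i %% n).
Proof. exact: tnth_nth. Qed.

Lemma unroll_period w : period (unroll w) n.
Proof. by move=> i; congr tnth; apply/val_inj; rewrite /= modnDr. Qed.

Lemma unroll_ord w (i : 'I_n) : unroll w i = tnth w i.
Proof. by congr tnth; apply/val_inj; rewrite /= modn_small. Qed.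

Lemma unroll_inj w w' : unroll w =1 unroll w' -> w = w'.
Proof. by move=> eq_u; apply: eq_from_tnth => i; rewrite -!unroll_ord. Qed.

Lemma unroll_mktuple (s : nat -> 'I_k) :
  period s n -> unroll [tuple s i | i < n] =1 s.
Proof. by move=> sn i; rewrite /unroll tnth_mktuple /= (period_eqmod sn (modn_mod i n)). Qed.

Lemma mem_necklace w w' :
  reflect (exists j, forall i, unroll w' i = unroll w (i + j)) (w' \in necklace w).
Proof.
have unroll_rot j i x0 : j <= n -> nth x0 (rot j w) (i %% n) = unroll w (i + j).
  move=> le_jn; rewrite (unroll_nth x0) /rot nth_cat size_drop size_tuple.
  have lt_in := ltn_pmod i n_gt0.
  have [lt_i|le_i] := ltnP (i %% n) (n - j).
    by rewrite nth_drop -modnDml (@modn_small (i %% n + j)) 1?[j + _]addnC //; lia.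
  rewrite nth_take; last by lia.
  have -> : (i + j) %% n = (i %% n - (n - j)) %% n.
    by rewrite -modnDml -(@modnDr (_ - _)) //; congr (_ %% _); lia.
  by rewrite (@modn_small (_ - _)) //; lia.
rewrite inE; apply: (iffP existsP) => [[j /eqP eq_w'] | [j eq_w']].
  exists j => i; have x0 := unroll w 0.
  by rewrite (unroll_nth x0) eq_w' unroll_rot // -ltnS.
have lt_j : j %% n < n.+1 by rewrite ltnW // ltnS ltn_pmod.
exists (Ordinal lt_j); apply/eqP/(@eq_from_nth _ (unroll w 0)) => [|i].
  by rewrite size_rot !size_tuple.
rewrite size_tuple => lt_in.
rewrite -[i in LHS](modn_small lt_in) -unroll_nth eq_w'.
rewrite -{2}(modn_small lt_in) unroll_rot //=.
by apply: (period_eqmod (@unroll_period w)); rewrite modnDmr.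
Qed.

Lemma necklace_id w : w \in necklace w.
Proof. by apply/mem_necklace; exists 0 => i; rewrite addn0. Qed.

Lemma eq_necklace w w' : (necklace w == necklace w') = (w' \in necklace w).
Proof.
apply/eqP/idP => [->|/mem_necklace[j eq_w']]; first exact: necklace_id.
apply/setP=> v; apply/mem_necklace/mem_necklace=> [] [l eq_v].
  (* [j * n.-1] is congruent to [-j] modulo [n], so it undoes the rotation by [j]. *)
  exists (l + j * n.-1) => i; rewrite eq_v eq_w'.
  apply: (period_eqmod (@unroll_period w)).
  have -> : i + (l + j * n.-1) + j = i + l + j * n by rewrite -{2}(prednK n_gt0) mulnS; lia.
  by rewrite -[RHS]modnDmr modnMl addn0.
by exists (l + j) => i; rewrite eq_v eq_w' addnA.
Qed.

(** A period may be replaced by its gcd with [n]; if this is less than [n], the word is a power of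
    its prefix of that length. Conversely, a word [q^r] has the length of [q] as a period. *)
Lemma primitiveP w :
  reflect (forall d, period (unroll w) d -> n %| d) (primitive_word w).
Proof.
apply: (iffP idP) => [prim_w d per_d | minw].
  have per_g := period_gcd n_gt0 (@unroll_period w) per_d.
  set g := gcdn n d in per_g; apply: contraR prim_w => ndvd.
  have g_n : g %| n := dvdn_gcdl n d.
  have g_gt0 : 0 < g by rewrite gcdn_gt0 n_gt0.
  have g_neq : g != n by apply: contraNneq ndvd => <-; apply: dvdn_gcdr.
  have lt_g : g < n by rewrite ltn_neqAle g_neq dvdn_leq.
  have def_n := divnK g_n; have lt_r : n %/ g < n.+2 by rewrite ltnS (leq_trans (leq_div _ _)).
  apply/existsP; exists (inord g); apply/existsP.
  have sz : size (take g w) == (inord g : 'I_n.+1).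
    by rewrite size_takel ?size_tuple ?inordK // ltnW // ltnS.
  exists (Tuple sz); apply/existsP; exists (Ordinal lt_r) => /=.
  rewrite ltn_divRL // mul1n lt_g /=; pose x0 := unroll w 0.
  have szg : size (take g w) = g by rewrite size_takel // size_tuple ltnW.
  apply/eqP/(@eq_from_nth _ x0); first by rewrite size_flatten_nseq szg def_n size_tuple.
  rewrite size_tuple => i lt_i; rewrite nth_flatten_nseq szg ?def_n //.
  rewrite nth_take ?ltn_pmod // -[i in LHS](modn_small lt_i) -unroll_nth.
  rewrite -(@modn_small (i %% g) n); last by rewrite (leq_trans (ltn_pmod _ g_gt0)) // ltnW.
  by rewrite -unroll_nth; apply: (period_eqmod per_g); rewrite modn_mod.
apply/negP => /existsP[j /existsP[q /existsP[r /andP[r_gt1 /eqP def_w]]]].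
have def_n : n = r * j by have := congr1 size def_w; rewrite size_flatten_nseq !size_tuple.
have j_n : j %| n by apply/dvdnP; exists r.
have j_gt0 : 0 < j := dvdn_gt0 n_gt0 j_n.
have /(dvdn_leq j_gt0) : n %| j.
  apply: minw => i; have x0 := unroll w 0.
  rewrite !(unroll_nth x0) def_w !nth_flatten_nseq; try by rewrite size_tuple -def_n ltn_pmod.
  by rewrite size_tuple !modn_dvdm ?modnDr.
by rewrite leqNgt [X in _ < X]def_n ltn_Pmull.
Qed.

Lemma necklace_primitive w w' : w' \in necklace w -> primitive_word w' = primitive_word w.
Proof.
rewrite -eq_necklace => /eqP eqN.
suff sub (v v' : n.-tuple 'I_k) : v' \in necklace v -> primitive_word v -> primitive_word v'.
  by apply/idP/idP; apply: sub; rewrite -eq_necklace eqN.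
move=> /mem_necklace[j eq_v'] /primitiveP minv; apply/primitiveP => d per_d; apply: minv.
apply: (@period_shift _ _ n j) => // [|t]; first exact: unroll_period.
have -> : j + t + d = t + d + j by lia.
by rewrite [j + t]addnC -!eq_v' per_d.
Qed.

End Necklace.

(** On [A] the map [f] factors through [g]. Applied both ways, this matches necklaces of words with
    those of their squares. *)
Lemma leq_card_imset (aT rT1 rT2 : finType) (f : aT -> rT1) (g : aT -> rT2)
    (A : {set aT}) :
  {in A &, forall x y, g x = g y -> f x = f y} -> #|f @: A| <= #|g @: A|.
Proof.
move=> eq_gf; have [->|[x0 Ax0]] := set_0Vmem A; first by rewrite !imset0 !cards0.
pose F y := f (odflt x0 [pick x in A | g x == y]).
suff sub : f @: A \subset F @: (g @: A).
  by apply: leq_trans (subset_leq_card sub) (leq_imset_card _ _).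
apply/subsetP=> _ /imsetP[x Ax ->]; apply/imsetP; exists (g x); first exact: imset_f.
rewrite /F; case: pickP => [y /andP[Ay /eqP eq_g]|/(_ x)]; last by rewrite Ax eqxx.
exact: eq_gf.
Qed.

(** * Squares of words and the count of good necklaces *)

Section Square.

Variables (k h : nat).
Hypotheses (h_gt0 : 0 < h) (hh_gt0 : 0 < h + h).
Implicit Types q : h.-tuple 'I_k.

Definition square q : (h + h).-tuple 'I_k := [tuple of q ++ q].

Lemma unroll_square q : unroll hh_gt0 (square q) =1 unroll h_gt0 q.
Proof.
move=> i; have x0 := unroll h_gt0 q 0.
rewrite !(unroll_nth _ x0) nth_cat size_tuple.
have -> : i %% h = (i %% (h + h)) %% h by rewrite modn_dvdm ?dvdn_addr.
have := ltn_pmod i hh_gt0; move: (i %% (h + h)) => j lt_j.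
have [lt_jh|le_hj] := ltnP j h; first by rewrite modn_small.
by rewrite -[j in RHS](subnK le_hj) modnDr modn_small //; lia.
Qed.

Lemma eq_necklace_square q q' :
  (necklace (square q) == necklace (square q')) = (necklace q == necklace q').
Proof.
rewrite (eq_necklace hh_gt0) (eq_necklace h_gt0).
apply/(mem_necklace hh_gt0)/(mem_necklace h_gt0) => [] [j eq_q']; exists j => i.
  by rewrite -!unroll_square.
by rewrite !unroll_square.
Qed.

Lemma square_nprimitive q : ~~ primitive_word (square q).
Proof.
apply/negP=> /(primitiveP hh_gt0)/(_ h) dvd_h.
have /dvdn_leq : h + h %| h.
  by apply: dvd_h => i; rewrite !unroll_square; apply: unroll_period.
by move/(_ h_gt0); lia.
Qed.

End Square.

Definition negative (sg : seq bool) k : pred 'I_k := fun x => ~~ nth true sg x.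

Lemma eq_parity k (neg : pred 'I_k) (s s' : nat -> 'I_k) i :
  s =1 s' -> parity neg s i = parity neg s' i.
Proof. by move=> eq_s; congr odd; apply: eq_bigr => t _; rewrite eq_s. Qed.

Lemma eq_period T (s s' : nat -> T) d : s =1 s' -> period s d -> period s' d.
Proof. by move=> eq_s sd i; rewrite -!eq_s. Qed.

Lemma parity_o_sig sg k n (n_gt0 : 0 < n) (w : n.-tuple 'I_k) :
  parity (negative sg (k:=k)) (unroll n_gt0 w) n = odd (o_sig sg w).
Proof.
congr odd; rewrite /o_sig -sum1_count big_tuple [RHS]big_mkcond /=.
by apply: eq_bigr => i _; rewrite unroll_ord /negative; case: nth.
Qed.

(** For odd [n] no square occurs. For [n = h + h], squaring is injective on necklaces of length [h],
    and its values on primitive words of odd parity are the good necklaces that are not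
    primitive. *)
Lemma card_good_necklace sg k n (n_gt0 : 0 < n) (G : {set {set n.-tuple 'I_k}}) :
  (forall X, X \in G <->
     exists2 w, good_word (negative sg (k:=k)) n (unroll n_gt0 w) & X = necklace w) ->
  #|G| = Lstar k sg n.
Proof.
move=> defG; rewrite /Lstar; have [n_odd|n_even] := boolP (odd n).
  rewrite addn0; congr #|pred_of_set _|; apply/setP=> X; apply/idP/imsetP.
    case/defG=> w good_w ->; exists w => //; rewrite inE; apply/(primitiveP n_gt0).
    by case: good_w => // [] [h [def_n _ _ _]]; lia.
  case=> w; rewrite inE => /(primitiveP n_gt0) min_w ->.
  by apply/defG; exists w => //; left.
have [h def_n] : exists h, n = h + h by exists n./2; lia.
subst n; have h_gt0 : 0 < h by lia.
have -> : (h + h)./2 = h by lia.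
pose A := [set w : h.-tuple 'I_k | primitive_word w && odd (o_sig sg w)].
have -> : Lneck_sig k sg h = #|[set necklace (square q) | q in A]|.
  by apply/eqP; rewrite eqn_leq !leq_card_imset // => q q' _ _ /eqP eq_qq';
     apply/eqP; move: eq_qq'; rewrite (eq_necklace_square h_gt0 n_gt0).
(* Primitivity is invariant under rotation and fails for squares, so the two families are
   disjoint. *)
rewrite /Lneck -cardsUI [X in _ + #|pred_of_set X|](_ : _ = set0); last first.
  apply/setP=> X; rewrite in_set0; apply/negP=> /setIP[/imsetP[w prim_w ->]].
  case/imsetP=> q _ /eqP; rewrite (eq_necklace n_gt0) => /(necklace_primitive n_gt0).
  by move: prim_w; rewrite inE (negbTE (square_nprimitive h_gt0 n_gt0 q)) => ->.
rewrite cards0 addn0; congr #|pred_of_set _|; apply/setP=> X; apply/idP/setUP.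
  case/defG=> w [min_w | [h' [eq_h per_h min_h odd_h]]] ->; [left | right].
    by apply/imsetP; exists w; rewrite // inE; apply/(primitiveP n_gt0).
  have {eq_h} def_h : h' = h by lia.
  subst h'; pose q := [tuple unroll n_gt0 w i | i < h].
  have eq_u : unroll h_gt0 q =1 unroll n_gt0 w by apply: unroll_mktuple.
  have def_w : w = square q.
    by apply: (@unroll_inj _ _ n_gt0) => i; rewrite (unroll_square h_gt0) eq_u.
  apply/imsetP; exists q; last by rewrite -def_w.
  rewrite inE -(parity_o_sig _ h_gt0) (eq_parity _ _ eq_u) odd_h andbT.
  by apply/(primitiveP h_gt0) => d per_d; apply: min_h; apply: eq_period per_d.
case=> /imsetP[w]; rewrite inE.
  by move=> /(primitiveP n_gt0) min_w ->; apply/defG; exists w => //; left.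
case/andP=> /(primitiveP h_gt0) min_w odd_w ->; apply/defG; exists (square w) => //.
have eq_u := unroll_square h_gt0 n_gt0 w.
right; exists h; split=> // [i|d per_d|].
- by rewrite !eq_u; apply: unroll_period.
- by apply: min_w; apply: eq_period per_d.
by rewrite (eq_parity _ _ eq_u) parity_o_sig.
Qed.

(** * Order-preserving maps of ['I_n] and iterates of a cyclic permutation *)

Lemma ltn_homo_ord_id n (f : 'I_n -> 'I_n) : {homo f : x y / x < y} -> f =1 id.
Proof.
move=> f_mono.
(* Strict growth bounds [f x] from below by counting up from 0 and, in [le_f], from above by
   counting down from the top. *)
have ge_f d (x : 'I_n) : x = d :> nat -> x <= f x.
  elim: d x => [|d IHd] x def_x; first by rewrite def_x.
  have lt_dn : d < n by rewrite ltnW // -def_x ltn_ord.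
  rewrite def_x; apply: leq_ltn_trans (f_mono (Ordinal lt_dn) x _); last by rewrite def_x /=.
  exact: (IHd (Ordinal lt_dn)).
have le_f d (x : 'I_n) : (x + d).+1 = n -> (f x + d).+1 <= n.
  elim: d x => [|d IHd] x def_x; first by rewrite addn0.
  have lt_xn : x.+1 < n by lia.
  have := f_mono x (Ordinal lt_xn) (ltnSn x); have := IHd (Ordinal lt_xn).
  by rewrite /=; lia.
move=> x; apply/val_inj => /=; have := ge_f x x erefl; have := le_f (n - x.+1) x.
by have := ltn_ord x; lia.
Qed.

(** The map sending [f i] to [g i] is strictly increasing on ['I_n], hence the identity. *)
Lemma ord_rank_inj n (f g : 'I_n -> 'I_n) : injective f ->
  (forall i j, (f i < f j) = (g i < g j)) -> f =1 g.
Proof.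
move=> f_inj eq_fg i; have mono : {homo g \o invF f_inj : x y / x < y}.
  by move=> x y; rewrite /= -eq_fg !f_invF.
by have := ltn_homo_ord_id mono (f i); rewrite /= invF_f.
Qed.

Section CyclicPerm.

Variables (n : nat) (p : {perm 'I_n}).
Hypothesis p_cyc : cyclic_perm p.

Lemma cyclic_porbit x : porbit p x = [set: 'I_n].
Proof.
have /cards1P[B defB] := p_cyc; apply/setP=> y; rewrite inE.
have porbB z : porbit p z = B by apply/set1P; rewrite -defB imset_f.
by rewrite porbB -(porbB y) porbit_id.
Qed.

Lemma cyclic_iter x y : exists i, y = iter i p x.
Proof.
have /porbitP[i ->] : y \in porbit p x by rewrite cyclic_porbit inE.
by exists i; rewrite permX.
Qed.

Lemma cyclic_iter_eq x i j : (iter i p x == iter j p x) = (i == j %[mod n]).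
Proof.
have n_gt0 : 0 < n by case: (n) x => [[]|].
have szp : #|porbit p x| = n by rewrite cyclic_porbit cardsT card_ord.
have iter_n a : iter (a * n) p x = x.
  by elim: a => // a IHa; rewrite mulSn iterD IHa -[RHS](iter_porbit p) szp.
have iter_mod a : iter a p x = nth x (traject p x n) (a %% n).
  by rewrite nth_traject ?ltn_pmod // {1}(divn_eq a n) addnC iterD iter_n.
rewrite !iter_mod nth_uniq ?size_traject ?ltn_pmod //.
by have := uniq_traject_porbit p x; rewrite szp.
Qed.

End CyclicPerm.

(** * Correspondence between colored cyclic permutations and good necklaces *)

Section Coloring.

Variables (sg : seq bool) (k n : nat).
Implicit Types (p : {perm 'I_n}) (c : {ffun 'I_n -> 'I_k}).
Local Notation neg := (negative sg (k:=k)).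

(* The classes of a coloring are the (possibly empty) consecutive segments
   witnessing membership in the class of [sg]. *)
Definition coloring p c := [forall x : 'I_n, forall y : 'I_n, (x < y) ==>
  (c x <= c y) && ((c x == c y) ==> ((p x < p y) == ~~ neg (c x)))].

Lemma coloringP p c : reflect (forall x y : 'I_n, x < y ->
   c x <= c y /\ (c x = c y -> (p x < p y) = ~~ neg (c x))) (coloring p c).
Proof.
apply: (iffP forallP) => [col x y lt_xy | col x].
  have /forallP/(_ y)/implyP/(_ lt_xy)/andP[le_c /implyP eq_c] := col x.
  by split=> // /eqP/eq_c/eqP.
apply/forallP=> y; apply/implyP=> /col[-> eq_c] /=.
by apply/implyP => /eqP/eq_c ->.
Qed.

Hypothesis n_gt0 : 0 < n.

Definition word p c x := [tuple c (iter i p x) | i < n].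

Section Word.

Variables (p : {perm 'I_n}) (c : {ffun 'I_n -> 'I_k}).
Hypothesis p_cyc : cyclic_perm p.

Lemma unroll_word x i : unroll n_gt0 (word p c x) i = c (iter i p x).
Proof.
rewrite (@unroll_mktuple _ _ n_gt0 (fun i => c (iter i p x))) // => j.
by congr (c _); apply/eqP; rewrite cyclic_iter_eq // modnDr.
Qed.

Lemma word_itinerary x : coloring p c ->
  itinerary neg n (unroll n_gt0 (word p c x)) (fun i => iter i p x).
Proof.
move=> /coloringP colP; split=> [|i j|i j|i j]; first exact: unroll_period.
- by rewrite -(cyclic_iter_eq p_cyc x).
- rewrite !unroll_word => lt_c; rewrite ltnNge; apply: contraL lt_c.
  rewrite -leqNgt leq_eqVlt => /orP[/eqP/val_inj->|/colP[]] //.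
rewrite !unroll_word !iterS.
move: (iter i p x) (iter j p x) => y z eq_c neq_yz.
case: (ltngtP y z) neq_yz => // lt_yz _.
  by rewrite (colP _ _ lt_yz).2 //; case: neg.
have := (colP _ _ lt_yz).2 (esym eq_c); rewrite eq_c.
have : p z != p y by rewrite (inj_eq perm_inj) -(inj_eq val_inj) neq_ltn lt_yz.
by rewrite -(inj_eq val_inj) /=; case: neg; case: ltngtP.
Qed.

Lemma mem_necklace_word x w :
  reflect (exists y, w = word p c y) (w \in necklace (word p c x)).
Proof.
apply: (iffP (mem_necklace n_gt0 _ _)) => [[j eq_w]|[y ->]].
  exists (iter j p x); apply: (@unroll_inj _ _ n_gt0) => i.
  by rewrite eq_w !unroll_word iterD.
have [j ->] := cyclic_iter p_cyc x y; exists j => i.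
by rewrite !unroll_word iterD.
Qed.

(* When [w] is a square it is the word of two points exchanged by [p ^ (n/2)];
   this selects the smaller one. *)
Lemma word_least_start x w : w \in necklace (word p c x) ->
  exists2 y, w = word p c y &
    forall h, n = h + h -> period (unroll n_gt0 w) h -> y < iter h p y.
Proof.
case/mem_necklace_word=> y def_w.
have [lt_y|ge_y] := boolP (y < iter n./2 p y).
  by exists y => // h def_n _; rewrite (_ : h = n./2); last by lia.
(* Here [y] is not the smaller point. If [w] is also the word of the opposite point, start there;
   otherwise half of [n] is not a period of [w] and the condition is void. *)
have [eq_w|neq_w] := eqVneq w (word p c (iter n./2 p y)); last first.
  exists y => // h def_n per_h; case/eqP: neq_w; apply: (@unroll_inj _ _ n_gt0) => i.
  rewrite unroll_word -iterD -(unroll_word y) -def_w.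
  by rewrite (_ : n./2 = h) ?per_h //; lia.
exists (iter n./2 p y) => // h def_n _; have -> : h = n./2 by lia.
rewrite -iterD; have -> : n./2 + n./2 = n by lia.
have /eqP -> : iter n p y == iter 0 p y by rewrite cyclic_iter_eq // modnn mod0n.
rewrite /= ltn_neqAle leqNgt ge_y andbT.
have : iter n./2 p y != iter 0 p y by rewrite cyclic_iter_eq // mod0n modn_small; lia.
by [].
Qed.

End Word.

(** With least starting points the comparison required by [itinerary_uniq] agrees, so both orbits
    have the same relative order. Each exhausts ['I_n], hence they coincide point by point. *)
Lemma word_inj p c p' c' x x' :
  cyclic_perm p -> coloring p c -> cyclic_perm p' -> coloring p' c' ->
  necklace (word p c x) = necklace (word p' c' x') -> p = p' /\ c = c'.
Proof.
move=> p_cyc col p'_cyc col' eqN.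
have w_p : word p c x \in necklace (word p c x) by apply: necklace_id.
have w_p' : word p c x \in necklace (word p' c' x') by rewrite -eqN.
have [y def_w lt_y] := word_least_start p_cyc w_p.
have [y' def_w' lt_y'] := word_least_start p'_cyc w_p'.
have it := word_itinerary p_cyc y col; have it' := word_itinerary p'_cyc y' col'.
rewrite -def_w in it; rewrite -def_w' in it'.
have eq_lt := itinerary_uniq n_gt0 it it'.
have {}eq_lt i j : (iter i p y < iter j p y) = (iter i p' y' < iter j p' y').
  by apply: eq_lt => h def_n per_h; rewrite /= lt_y ?lt_y'.
have eq_iter i : iter i p y = iter i p' y'.
  have f_inj : injective (fun i : 'I_n => iter i p y).
    move=> a b /eqP; rewrite cyclic_iter_eq // !modn_small // => /eqP.
    exact: val_inj.
  have eq_f := ord_rank_inj f_inj (fun a b : 'I_n => eq_lt a b).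
  have /= := eq_f (Ordinal (ltn_pmod i n_gt0)).
  have /eqP -> : iter (i %% n) p y == iter i p y by rewrite cyclic_iter_eq // modn_mod.
  by have /eqP -> : iter (i %% n) p' y' == iter i p' y' by rewrite cyclic_iter_eq // modn_mod.
split; [apply/permP | apply/ffunP] => z; have [i ->] := cyclic_iter p_cyc y z.
  by rewrite [in RHS]eq_iter -!iterS eq_iter.
by rewrite -(unroll_word _ p_cyc) -def_w [in RHS]eq_iter -(unroll_word _ p'_cyc) -def_w'.
Qed.

(** The positions of the word are laid out on the line in the order of their keys, and [p] moves the
    place of each position to the place of the next. *)
Lemma good_word_realized w : good_word neg n (unroll n_gt0 w) ->
  exists p c x, [/\ cyclic_perm p, coloring p c & w = word p c x].
Proof.
move=> good_w; have it := orbit_key_itinerary n_gt0 (unroll_period n_gt0 w) good_w.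
set key := orbit_key _ _ _ in it.
pose below (i : 'I_n) := [set j : 'I_n | key j < key i].
have lt_below i : #|below i| < n.
  rewrite -[n in _ < n]card_ord -cardsT; apply: proper_card.
  by apply/properP; split; [exact: subsetT | exists i; rewrite !inE ?ltnn].
pose rk i := Ordinal (lt_below i).
have rk_lt (i j : 'I_n) : key i < key j -> rk i < rk j.
  move=> lt_ij; apply: proper_card; apply/properP; split.
    by apply/subsetP=> a; rewrite !inE => /ltn_trans; apply.
  by exists i; rewrite !inE ?ltnn.
have key_inj (i j : 'I_n) : key i = key j -> i = j.
  move/eqP; rewrite (itin_eq it) !modn_small // => /eqP; exact: val_inj.
have rk_inj : injective rk.
  move=> i j eq_rk; apply: key_inj; apply/eqP.
  by case: ltngtP => // /rk_lt; rewrite eq_rk ltnn.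
have rkE (i j : 'I_n) : (rk i < rk j) = (key i < key j).
  apply/idP/idP; last exact: rk_lt.
  case: (ltngtP (key i) (key j)) => // [/rk_lt|/key_inj ->]; last by rewrite ltnn.
  by case: ltngtP.
pose R := perm rk_inj; pose S := perm (@ordS_inj n).
pose p := (R^-1 * S * R)%g; pose c := [ffun z => tnth w (R^-1 z)%g].
have pR i : p (R i) = R (ordS i) by rewrite !permM permK !permE.
have cR i : c (R i) = tnth w i by rewrite ffunE permK.
pose o i := Ordinal (ltn_pmod i n_gt0).
have iterR i : iter i p (R (o 0)) = R (o i).
  elim: i => // i IHi; rewrite iterS IHi pR; congr (R _); apply/val_inj.
  by rewrite /= -[i.+1]addn1 -[(_ %% _).+1]addn1 modnDml.
have oK (i : 'I_n) : o i = i by apply/val_inj; rewrite /= modn_small.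
have p_cyc : cyclic_perm p.
  apply/cards1P; exists (porbit p (R (o 0))); apply/setP=> B; rewrite inE.
  have all_p z : porbit p z = porbit p (R (o 0)).
    apply/eqP; rewrite eq_porbit_mem; apply/porbitP; exists (R^-1 z)%g.
    by rewrite permX iterR oK permKV.
  apply/imsetP/eqP => [[z _ ->] | ->] //.
  by exists (R (o 0)).
have col : coloring p c.
  apply/coloringP => x y; rewrite -[x](permKV R) -[y](permKV R).
  move: (R^-1 x)%g (R^-1 y)%g => i j; rewrite !pR !cR !permE rkE => lt_ij.
  rewrite -!(unroll_ord n_gt0); split.
    by rewrite leqNgt; apply: contraL lt_ij => /(itin_lt it); case: ltngtP.
  move=> eq_u; have := itin_step it eq_u; rewrite lt_ij neq_ltn lt_ij => /(_ isT).
  have keyS (a : 'I_n) : key (ordS a) = key a.+1.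
    by apply/eqP; rewrite (itin_eq it) /= modn_mod.
  by rewrite rkE !keyS; case: (_ < _); case: neg.
exists p, c, (R (o 0)); split=> //; apply: (@unroll_inj _ _ n_gt0) => i.
by rewrite unroll_word // iterR cR.
Qed.

(** The word is read from the base point [x0]; another base point only rotates it. So the necklace
    determines the colored permutation by [word_inj], and every good necklace is reached. *)
Theorem card_colored_cycles :
  #|[set pc : {perm 'I_n} * {ffun 'I_n -> 'I_k} |
      cyclic_perm pc.1 && coloring pc.1 pc.2]| = Lstar k sg n.
Proof.
pose x0 := Ordinal n_gt0.
pose N (pc : {perm 'I_n} * {ffun 'I_n -> 'I_k}) := necklace (word pc.1 pc.2 x0).
rewrite -(@card_in_imset _ _ N); last first.
  move=> [p c] [p' c']; rewrite !inE /= => /andP[p_cyc col] /andP[p'_cyc col'].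
  by case/(word_inj p_cyc col p'_cyc col') => -> ->.
apply: (@card_good_necklace sg k n n_gt0) => X; split.
  case/imsetP=> [[p c]]; rewrite !inE /= => /andP[p_cyc col] ->.
  exists (word p c x0) => //.
  exact: itinerary_good n_gt0 (word_itinerary p_cyc x0 col).
case=> w /good_word_realized[p [c [x [p_cyc col ->]]]] ->.
apply/imsetP; exists (p, c); first by rewrite inE p_cyc.
apply/eqP; rewrite (eq_necklace n_gt0); apply/(mem_necklace_word _ p_cyc).
by exists x0.
Qed.

End Coloring.

(** * Cut points of a down-up-down sequence *)

Section Segmentation.

Variables (n : nat) (f : nat -> nat).

Definition down_up_down a b := forall i j, i < j < n ->
  [/\ j < a -> f j < f i, a <= i -> j < b -> f i < f j & b <= i -> f j < f i].

Lemma down_up_down_adjacent a b :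
  (forall i, i.+1 < n ->
    [/\ i.+1 < a -> f i.+1 < f i, a <= i -> i.+1 < b -> f i < f i.+1
      & b <= i -> f i.+1 < f i]) -> down_up_down a b.
Proof.
move=> adj i j /andP[]; elim: j => // j IHj; rewrite ltnS leq_eqVlt.
case/orP=> [/eqP <-|lt_ij] lt_jn; first exact: adj.
have [d1 u d2] := adj j lt_jn; have [D1 U D2] := IHj lt_ij (ltnW lt_jn).
split=> *; [apply: ltn_trans (d1 _) (D1 _)| apply: ltn_trans (U _ _) (u _ _)
  | apply: ltn_trans (d2 _) (D2 _)]; lia.
Qed.

(* The first cut lies just before or just after the bottom of the valley, the
   second just before or just after the top of the peak. *)
Lemma down_up_down_cuts a0 b0 : {in gtn n &, injective f} -> a0 <= b0 <= n -> down_up_down a0 b0 ->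
  (exists2 i, i.+1 < n & f i < f i.+1) ->
  exists u v, [/\ u <= v, v.+1 < n & forall a b, a <= b <= n ->
    down_up_down a b <-> (a \in [:: u; u.+1]) && (b \in [:: v.+1; v.+2])].
Proof.
move=> f_inj le_ab0 dud0 [i0 lt_i0 asc0]; pose asc i := (i.+1 < n) && (f i < f i.+1).
have ex_asc : exists i, asc i by exists i0; rewrite /asc lt_i0.
have asc_le i : asc i -> i <= n by case/andP=> /ltnW/ltnW.
(* [u] is the first ascent and [v] the last. *)
case: (ex_minnP ex_asc) => u /andP[lt_un asc_u] min_u.
case: (ex_maxnP ex_asc asc_le) => v /andP[lt_vn asc_v] max_v.
have le_uv : u <= v by apply: max_v; rewrite /asc lt_un.
have cuts a b : a <= b <= n -> down_up_down a b ->
    [/\ a <= u.+1, v < b & a <= b].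
  move=> le_ab dud; have := dud u u.+1; have := dud v v.+1.
  rewrite !ltnSn lt_un lt_vn => /(_ isT)[D1 U D2] /(_ isT)[D1' U' D2'].
  split; last by lia.
    by rewrite leqNgt; apply/negP => /D1'; lia.
  by rewrite ltnNge; apply/negP => /D2; lia.
have desc i : i.+1 < n -> ~~ asc i -> f i.+1 < f i.
  move=> lt_in; rewrite /asc lt_in /= -leqNgt leq_eqVlt => /orP[/eqP eq_f|//].
  by have := f_inj _ _ lt_in (ltnW lt_in) eq_f; lia.
exists u, v; split=> // a b le_ab; split=> [dud | ].
  have [le_au lt_vb _] := cuts _ _ le_ab dud.
  rewrite !inE; apply/andP; split.
    (* A first cut before [u] would put [u.-1] and [u] in the increasing segment, giving an ascent
       before the first one. The second cut is symmetric. *)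
    have [lt_au|] := ltnP a u; last by lia.
    have := dud u.-1 u; rewrite (_ : u.-1 < u < n); last by lia.
    case/(_ isT)=> _ U _; have : u <= u.-1; last by lia.
    by apply: min_u; rewrite /asc prednK ?U; lia.
  have [lt_vb2|] := ltnP v.+2 b; last by lia.
  have := dud v.+1 v.+2; rewrite (_ : v.+1 < v.+2 < n); last by lia.
  case/(_ isT)=> _ U _; have : v.+1 <= v; last by lia.
  by apply: max_v; rewrite /asc U; lia.
rewrite !inE => /andP[a_u b_v]; apply: down_up_down_adjacent => i lt_in.
split=> [lt_ia|le_ai lt_ib|le_bi].
- by apply: desc => //; apply/negP => /min_u; lia.
- have [-> //|neq_u] := eqVneq i u; have [-> //|neq_v] := eqVneq i v.
  (* Strictly between [u] and [v] the increase comes from the given cuts, whose middle segment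
     covers [u.+1] to [v]. *)
  have [le_a0u lt_vb0 _] := cuts _ _ le_ab0 dud0.
  have := dud0 i i.+1; rewrite ltnSn lt_in => /(_ isT)[_ U _].
  by apply: U; lia.
by apply: desc => //; apply/negP => /max_v; lia.
Qed.

End Segmentation.

(** * Colorings for [-+-] as pairs of cuts, and their number *)

Section Cuts.

Variable n : nat.
Implicit Types (p : {perm 'I_n.+1}) (c : {ffun 'I_n.+1 -> 'I_3}).

Definition cut_coloring (ab : 'I_n.+2 * 'I_n.+2) : {ffun 'I_n.+1 -> 'I_3} :=
  [ffun x : 'I_n.+1 => inord ((ab.1 <= x) + (ab.2 <= x))].

Lemma val_cut_coloring ab x :
  cut_coloring ab x = (ab.1 <= x) + (ab.2 <= x) :> nat.
Proof. by rewrite ffunE inordK //; case: (ab.1 <= x); case: (ab.2 <= x). Qed.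

(** The cuts are recovered as the first positions of color at least 1 and at least 2, or [n.+1] if
    there are none. *)
Lemma cut_coloring_inj : 
  {in [pred ab : 'I_n.+2 * 'I_n.+2 | ab.1 <= ab.2] &, injective cut_coloring}.
Proof.
move=> [a b] [a' b']; rewrite !inE /= => le_ab le_ab' eq_c.
have eq_x (x : 'I_n.+1) : (a <= x) + (b <= x) = (a' <= x) + (b' <= x).
  by rewrite -(val_cut_coloring (a, b)) eq_c val_cut_coloring.
have := ltn_ord a; have := ltn_ord b; have := ltn_ord a'; have := ltn_ord b'.
move=> lt_b' lt_a' lt_b lt_a.
have eq_n i : i < n.+1 -> (a <= i) + (b <= i) = (a' <= i) + (b' <= i).
  by move=> lt_i; apply: (eq_x (Ordinal lt_i)).
congr pair; apply/val_inj => /=.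
  by have := eq_n a; have := eq_n a'; lia.
by have := eq_n b; have := eq_n b'; lia.
Qed.

Lemma upward_threshold (P : pred 'I_n.+1) :
  (forall x y : 'I_n.+1, x < y -> P x -> P y) ->
  exists a : 'I_n.+2, forall x : 'I_n.+1, P x = (a <= x).
Proof.
(* The value [n.+1] serves as threshold when [P] holds nowhere. *)
move=> upP; pose Q m := (m == n.+1) || [exists x : 'I_n.+1, (x == m :> nat) && P x].
have exQ : exists m, Q m by exists n.+1; rewrite /Q eqxx.
case: (ex_minnP exQ) => a Qa min_a.
have lt_a : a < n.+2 by rewrite ltnS min_a // /Q eqxx.
exists (Ordinal lt_a) => x /=; apply/idP/idP => [Px | le_ax].
  by apply: min_a; apply/orP; right; apply/existsP; exists x; rewrite eqxx.
case/orP: Qa => [/eqP def_a|/existsP[y /andP[/eqP def_a Py]]].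
  by have := ltn_ord x; lia.
move: le_ax; rewrite -def_a leq_eqVlt => /orP[/eqP/val_inj <- //|lt_yx].
exact: upP lt_yx Py.
Qed.

Lemma coloring_cuts p c : coloring sigma4 p c ->
  exists2 ab : 'I_n.+2 * 'I_n.+2, ab.1 <= ab.2 & c = cut_coloring ab.
Proof.
move/coloringP=> col.
have le_c (x y : 'I_n.+1) : x < y -> c x <= c y by case/col.
have [|a Pa] := @upward_threshold (fun x => 0 < c x).
  by move=> x y /le_c; lia.
have [|b Pb] := @upward_threshold (fun x => 1 < c x).
  by move=> x y /le_c; lia.
exists (a, b) => /=; last first.
  apply/ffunP=> x; apply/val_inj; rewrite /= val_cut_coloring /= -Pa -Pb.
  by have := ltn_ord (c x); lia.
have [lt_bn|] := ltnP b n.+1; last by have := ltn_ord a; lia.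
by have := Pa (Ordinal lt_bn); have := Pb (Ordinal lt_bn); rewrite /= leqnn; lia.
Qed.

Lemma cut_coloringP p (ab : 'I_n.+2 * 'I_n.+2) : ab.1 <= ab.2 ->
  reflect (down_up_down n.+1 (fun i => p (inord i)) ab.1 ab.2)
          (coloring sigma4 p (cut_coloring ab)).
Proof.
case: ab => a b /= le_ab.
have negE x : negative sigma4 (cut_coloring (a, b) x) = (x < a) || (b <= x).
  rewrite /negative val_cut_coloring /=.
  by case: (leqP a x); case: (leqP b x) => //; lia.
apply: (iffP (coloringP _ _ _)) => [col i j /andP[lt_ij lt_jn] | dud x y lt_xy].
  have lt_in := ltn_trans lt_ij lt_jn.
  have [|_ col_ij] := col (inord i) (inord j); first by rewrite !inordK.
  have neq_p : p (inord i) != p (inord j) :> nat.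
    rewrite (inj_eq val_inj) (inj_eq perm_inj) -(inj_eq val_inj) /= !inordK //.
    by rewrite neq_ltn lt_ij.
  have {}col_ij : (a <= i) + (b <= i) = (a <= j) + (b <= j) ->
      (p (inord i) < p (inord j)) = ~~ ((i < a) || (b <= i)).
    move=> eq_ij; rewrite col_ij ?negE ?inordK //.
    by apply/val_inj; rewrite /= !val_cut_coloring /= !inordK.
  by split=> *; lia.
have := dud x y; rewrite lt_xy ltn_ord !inord_val => /(_ isT)[D1 U D2].
split; first by rewrite !val_cut_coloring /=; lia.
move/(congr1 val); rewrite /= !val_cut_coloring negE /=; lia.
Qed.

(** The outer end points of a segmentation are forced, so only the two inner cuts carry
    information. *)
Lemma in_sigma4_class p :
  in_sigma_class sigma4 p = [exists c : {ffun 'I_n.+1 -> 'I_3}, coloring sigma4 p c].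
Proof.
apply/existsP/existsP => [[e /and4P[/eqP e0 /eqP e3 /forallP le_e /forallP seg]] | [c col]].
  have le_e12 := le_e (Ordinal (isT : 1 < 3)).
  exists (cut_coloring (e (inord 1), e (inord 2))); apply/cut_coloringP => //.
  have dir (t : 'I_3) i j : i < j < n.+1 -> e (inord t) <= i -> j < e (inord t.+1) ->
      if nth true sigma4 t then p (inord i) < p (inord j) else p (inord j) < p (inord i).
    move=> /andP[lt_ij lt_jn] le_i lt_j; have lt_in := ltn_trans lt_ij lt_jn.
    have /forallP/(_ (inord i))/forallP/(_ (inord j))/implyP := seg t.
    by rewrite !inordK // lt_ij le_i lt_j; apply.
  have e0' : e (inord 0) = 0 :> nat by rewrite (_ : inord 0 = ord0) //; apply/val_inj; rewrite /= inordK.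
  have e3' : e (inord 3) = n.+1 :> nat by rewrite (_ : inord 3 = ord_max) //; apply/val_inj; rewrite /= inordK.
  move=> i j ij; have /andP[lt_ij lt_jn] := ij; split=> [lt_j | le_i lt_j | le_i].
  - by apply: (dir (Ordinal (isT : 0 < 3)) _ _ ij); rewrite /= ?e0'.
  - by apply: (dir (Ordinal (isT : 1 < 3)) _ _ ij).
  - by apply: (dir (Ordinal (isT : 2 < 3)) _ _ ij); rewrite /= ?e3'.
have [[a b] /= le_ab def_c] := coloring_cuts col; move: col; rewrite def_c.
move/(cut_coloringP _ (ab := (a, b)) le_ab) => /= dud.
(* The default [ord_max] supplies the last end point. *)
pose e := [ffun i : 'I_4 => nth ord_max [:: ord0; a; b] i].
have eE i : i < 4 -> e (inord i) = nth ord_max [:: ord0; a; b] i by move=> lt_i; rewrite ffunE inordK.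
exists e; rewrite !ffunE /=; apply/and3P; split=> //.
  by apply/forallP=> [] [[|[|[|//]]] lt_t] /=; rewrite !eE //= -ltnS.
apply/forallP=> t; apply/forallP=> x; apply/forallP=> y; apply/implyP=> /and3P[].
have := dud x y; rewrite !inord_val ltn_ord andbT.
case: t => [] [|[|[|//]]] lt_t /=; rewrite !eE //= => dud_xy le_x lt_xy lt_y.
- by case: (dud_xy lt_xy) => D1 _ _; apply: D1.
- by case: (dud_xy lt_xy) => _ U _; apply: U.
by case: (dud_xy lt_xy) => _ _ D2; apply: D2.
Qed.

(** A permutation without ascent is the reversal, an involution, while the square of a cycle on at
    least three points fixes no point. *)
Lemma cyclic_has_ascent p : 2 < n.+1 -> cyclic_perm p ->
  exists2 i, i.+1 < n.+1 & p (inord i) < p (inord i.+1).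
Proof.
move=> n_gt2 p_cyc; pose x0 : 'I_n.+1 := ord0.
have [/existsP[i asc_i]|/existsPn noasc] :=
  boolP [exists i : 'I_n, p (inord i) < p (inord i.+1)].
  by exists i; rewrite // ltnS.
have dec : down_up_down n.+1 (fun i => p (inord i)) 0 0.
  apply: down_up_down_adjacent => i lt_in; split=> // _.
  have := noasc (Ordinal (lt_in : i < n)); rewrite -leqNgt leq_eqVlt => /orP[|//] /=.
  rewrite (inj_eq val_inj) (inj_eq perm_inj) -(inj_eq val_inj) /= !inordK //; lia.
have p_rev : p \o @rev_ord n.+1 =1 id.
  apply: ltn_homo_ord_id => x y lt_xy /=.
  have := dec (rev_ord y) (rev_ord x); rewrite !inord_val => -[|_ _ -> //].
  by have := ltn_ord y; rewrite /=; lia.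
have p_revE x : p x = rev_ord x by rewrite -{1}(rev_ordK x) [LHS]p_rev.
have : iter 2 p x0 == iter 0 p x0 by rewrite /= !p_revE rev_ordK.
by rewrite cyclic_iter_eq // mod0n modn_small.
Qed.

Lemma card_sigma4_coloring p : 2 < n.+1 -> cyclic_perm p ->
  #|[set c : {ffun 'I_n.+1 -> 'I_3} | coloring sigma4 p c]| = in_sigma_class sigma4 p * 4.
Proof.
move=> n_gt2 p_cyc; rewrite in_sigma4_class.
case: existsP => [[c0 col0]|no_col]; last first.
  apply/eqP; rewrite cards_eq0; apply/eqP/setP=> c; rewrite !inE.
  by apply/negP=> col; apply: no_col; exists c.
have [ab0 le_ab0 def_c0] := coloring_cuts col0; rewrite {}def_c0 in col0.
have /(cut_coloringP _ le_ab0) dud0 := col0.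
have f_inj : {in gtn n.+1 &, injective (fun i => p (inord i) : nat)}.
  move=> i j; rewrite !inE => lt_i lt_j /val_inj/perm_inj/(congr1 val) /=.
  by rewrite !inordK.
have le_n (ab : 'I_n.+2 * 'I_n.+2) : ab.1 <= ab.2 -> ab.1 <= ab.2 <= n.+1.
  by move=> ->; rewrite -ltnS ltn_ord.
have [u [v [le_uv lt_vn cuts]]] :=
  down_up_down_cuts f_inj (le_n _ le_ab0) dud0 (cyclic_has_ascent n_gt2 p_cyc).
(* Two choices for each cut; [u <= v] keeps every pair ordered, and [v.+2 <= n.+1] keeps it in
   range. *)
pose B : {set 'I_n.+2 * 'I_n.+2} :=
  setX [set inord u; inord u.+1] [set inord v.+1; inord v.+2].
have memB (ab : 'I_n.+2 * 'I_n.+2) : (ab \in B) = ((ab.1 : nat) \in [:: u; u.+1]) && ((ab.2 : nat) \in [:: v.+1; v.+2]).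
  by rewrite !inE -!(inj_eq val_inj) /= !inordK //; lia.
have le_B (ab : 'I_n.+2 * 'I_n.+2) : ab \in B -> ab.1 <= ab.2 by rewrite memB !inE; lia.
have -> : [set c : {ffun 'I_n.+1 -> 'I_3} | coloring sigma4 p c] = cut_coloring @: B.
  apply/setP=> c; rewrite inE; apply/idP/imsetP => [col | [ab Bab ->]].
    have [ab le_ab def_c] := coloring_cuts col; exists ab => //.
    by rewrite memB; apply/cuts; rewrite ?le_n //; apply/cut_coloringP; rewrite // -def_c.
  apply/cut_coloringP; first exact: le_B.
  by apply/cuts; rewrite -?memB // le_n // le_B.
rewrite card_in_imset; last first.
  by move=> ab ab' /le_B le_ab /le_B le_ab'; apply: cut_coloring_inj.
by rewrite cardsX !cards2 -!(inj_eq val_inj) /= !inordK ?ltn_eqF //; lia.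
Qed.

End Cuts.

Theorem theorem3p2 (n : nat) : 3 <= n ->
  ((c4 n)%:R : rat) = ((Lstar 3 sigma4 n)%:R / 4%:R)%R.
Proof.
case: n => // n n_gt2; rewrite -(card_colored_cycles sigma4 3 (ltn0Sn n)).
suff -> : #|[set pc : {perm 'I_n.+1} * {ffun 'I_n.+1 -> 'I_3} |
    cyclic_perm pc.1 && coloring sigma4 pc.1 pc.2]| = c4 n.+1 * 4.
  by rewrite GRing.natrM GRing.mulfK.
(* Grouping the pairs by permutation, each cyclic [p] contributes 4 if it lies in the class and 0
   otherwise. *)
rewrite -sum1dep_card -(pair_big_dep (@cyclic_perm n.+1) (@coloring sigma4 3 n.+1) (fun _ _ => 1)) /=.
rewrite /c4 /cyc_class_count -sum1dep_card big_mkcondr big_distrl /=.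
by apply: eq_bigr => p p_cyc; rewrite sum1dep_card card_sigma4_coloring.
Qed.
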